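(* Fix $\tau>0$ and $h>0$. There exists $\delta_0>0$ such that for all $0<\delta\le\delta_0$ and all $\rho^n\in[P_{h,\delta}]^s$, the minimizer $u=(\rho,m,\phi)$ of $\mathcal F_h$ over $V^n_{h,\delta}$ does not touch the boundary of $V^n_{h,\delta}$, i.e. $\rho_{i,j}>\delta$ for all $1\le i\le s$, $1\le j\le N$. Consequently, if $\rho^0>0$ (i.e. $\rho^0_{i,j}>0$ for all $i,j$, with $h\sum_j\rho^0_{i,j}=1$), then, for $\delta>0$ sufficiently small, the sequence generated by the fully discrete scheme, in which $\rho^{n+1}$ is the $\rho$-component of $\arg\min_{u\in V^n_{h,\delta}}\mathcal F_h(u)$, satisfies $\rho^n>0$ for all $n>0$. The objects $P_{h,\delta}$, $\mathcal F_h$ and $V^n_{h,\delta}$ are defined in the context.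
   Context: Grid: $[a,b]$ is divided into $N$ cells $[x_{j-1/2},x_{j+1/2}]$ of size $h=(b-a)/N$ with $x_{1/2}=a$, $x_{N+1/2}=b$ and centers $x_j=x_{j-1/2}+h/2$, $j=1,\dots,N$. Data: number of species $s\ge1$; $z_i\in\mathbb{R}$; positive functions $D_i$ and $\epsilon$ on $[a,b]$; a function $f$; constants $\beta_a,\beta_b>0$ (Robin conditions at both ends); boundary values $\phi^b(a),\phi^b(b)\in\mathbb{R}$. Write $\epsilon_j=\epsilon(x_j)$, $\epsilon_{j+1/2}=\epsilon(x_{j+1/2})$, $f_j=f(x_j)$, $D_{i,j}=D_i(x_j)$. Unknowns: $u=(\rho,m,\phi)$ with $\rho=(\rho_{i,j})_{1\le i\le s,1\le j\le N}$, $m=(m_{i,j+1/2})_{1\le i\le s,1\le j\le N-1}$ extended by $m_{i,1/2}=m_{i,N+1/2}=0$, and $\phi=(\phi_0,\dots,\phi_{N+1})$. Operators: $(D_hv)_{j+1/2}=(v_{j+1}-v_j)/h$, $(d_hv)_j=(v_{j+1/2}-v_{j-1/2})/h$, $\hat v_j=(v_{j+1/2}+v_{j-1/2})/2$; $\hat m_{i,j}$ denotes the average of $m_i$ at $j$. Discrete Poisson constraint $L_h(\phi,\rho)=0$ is the system $$(h+2\beta_a\epsilon(a))\phi_0+(h-2\beta_a\epsilon(a))\phi_1-2h\phi^b(a)=0,$$ $$-d_h(\epsilon D_h\phi)_j-f_j-\sum_{i=1}^sz_i\rho_{i,j}=0,\quad j=1,\dots,N,$$ $$(h-2\beta_b\epsilon(b))\phi_N+(h+2\beta_b\epsilon(b))\phi_{N+1}-2h\phi^b(b)=0,$$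 where $(\epsilon D_h\phi)_{j+1/2}=\epsilon_{j+1/2}(D_h\phi)_{j+1/2}$. Sets: $P_{h,\delta}=\{(\rho_1,\dots,\rho_N):\rho_j\ge\delta,\ h\sum_{j=1}^N\rho_j=1\}$, and, for given $\rho^n$, $$V^n_{h,\delta}=\{(\rho,m,\phi):\ \rho_{i,j}-\rho^n_{i,j}+d_h(m_i)_j=0\ \ (1\le i\le s,\ 1\le j\le N),\ \rho\in[P_{h,\delta}]^s,\ L_h(\phi,\rho)=0\},$$ with $m_{i,1/2}=m_{i,N+1/2}=0$. ''Touching the boundary'' of $V^n_{h,\delta}$ means $\rho_{i,j}=\delta$ for some $i,j$. Objective: $$\mathcal F_h(\rho,m,\phi)=\frac h{2\tau}\sum_{j=1}^N\sum_{i=1}^s\frac{\hat m_{i,j}^2}{\rho_{i,j}}D_{i,j}^{-1}+h\sum_{j=1}^N\Big(\sum_{i=1}^s\rho_{i,j}\log\rho_{i,j}+\frac{\epsilon_j}{8h^2}(\phi_{j+1}-\phi_{j-1})^2\Big)+\frac{(\phi_0+\phi_1)^2}{8\beta_a}+\frac{(\phi_N+\phi_{N+1})^2}{8\beta_b}.$$ *)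

(* Defs.v *)
From HB Require Import structures.
From mathcomp Require Import all_boot all_order all_algebra.
From mathcomp Require Import all_classical all_reals all_analysis.

Set Implicit Arguments.
Unset Strict Implicit.
Unset Printing Implicit Defensive.

Import Order.TTheory GRing.Theory Num.Theory.
Import numFieldNormedType.Exports.

Local Open Scope classical_set_scope.
Local Open Scope ring_scope.

(* Indexing: the cell j : 'I_N is the j.+1-st cell of the mathematical text,
   the face k : 'I_N.+1 carries the half-integer index k + 1/2, and the nodes
   of the potential, including the two ghost nodes, are 0, ..., N + 1. Hence
   cell j lies between faces j and j.+1 and has potential index j.+1. *)

Record pnp_data (R : realType) (s N : nat) := PnpData {
  left_end : R;
  right_end : R;
  valence : 'I_s -> R;
  diffusivity : 'I_s -> R -> R;
  permittivity : R -> R;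
  fixed_charge : R -> R;
  robin_left : R;
  robin_right : R;
  phi_left : R;
  phi_right : R }.

Record unknowns (R : realType) (s N : nat) := Unknowns {
  rho : 'M[R]_(s, N);
  flux : 'M[R]_(s, N.+1);
  potential : 'rV[R]_N.+2 }.

Definition standing_assumptions (R : realType) (s N : nat) (p : pnp_data R s N) :=
  [/\ left_end p < right_end p,
      forall i x, left_end p <= x <= right_end p -> 0 < diffusivity p i x,
      forall x, left_end p <= x <= right_end p -> 0 < permittivity p x,
      0 < robin_left p
    & 0 < robin_right p].

Definition mesh (R : realType) (s N : nat) (p : pnp_data R s N) : R :=
  (right_end p - left_end p) / N%:R.

Definition face (R : realType) (s N : nat) (p : pnp_data R s N) (k : nat) : R :=
  left_end p + k%:R * mesh p.

Definition center (R : realType) (s N : nat) (p : pnp_data R s N) (j : nat) : R :=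
  face p j + mesh p / 2.

(* [lift ord_max k] has value k and [lift ord0 k] has value k.+1, so these act
   both from nodes to faces (n = N.+1) and from faces to cells (n = N). *)
Definition difference (R : realType) (h : R) (n : nat) (v : 'rV[R]_n.+1) : 'rV[R]_n :=
  \row_k ((v 0 (lift ord0 k) - v 0 (lift ord_max k)) / h).

Definition average (R : realType) (n : nat) (v : 'rV[R]_n.+1) : 'rV[R]_n :=
  \row_k ((v 0 (lift ord0 k) + v 0 (lift ord_max k)) / 2).

Definition poisson (R : realType) (s N : nat) (p : pnp_data R s N)
    (phi : 'rV[R]_N.+2) (r : 'M[R]_(s, N)) : Prop :=
  let h := mesh p in
  let ba := robin_left p * permittivity p (left_end p) in
  let bb := robin_right p * permittivity p (right_end p) in
  let eps_Dphi := \row_k (permittivity p (face p k) * difference h phi 0 k) in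
  [/\ (h + 2 * ba) * phi 0 (inord 0) + (h - 2 * ba) * phi 0 (inord 1)
        - 2 * h * phi_left p = 0,
      forall j : 'I_N,
        - difference h eps_Dphi 0 j - fixed_charge p (center p j)
          - \sum_(i < s) valence p i * r i j = 0
    & (h - 2 * bb) * phi 0 (inord N) + (h + 2 * bb) * phi 0 (inord N.+1)
        - 2 * h * phi_right p = 0].

Definition density_set (R : realType) (s N : nat) (p : pnp_data R s N)
    (delta : R) : set 'rV[R]_N :=
  [set r | (forall j, delta <= r 0 j) /\ mesh p * \sum_j r 0 j = 1].

Definition densities_set (R : realType) (s N : nat) (p : pnp_data R s N)
    (delta : R) : set 'M[R]_(s, N) :=
  [set r | forall i, density_set p delta (row i r)].

Definition admissible (R : realType) (s N : nat) (p : pnp_data R s N)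
    (delta : R) (rhon : 'M[R]_(s, N)) : set (unknowns R s N) :=
  [set u | [/\ forall i, flux u i ord0 = 0 /\ flux u i ord_max = 0,
               forall i j, rho u i j - rhon i j
                 + difference (mesh p) (row i (flux u)) 0 j = 0,
               densities_set p delta (rho u)
             & poisson p (potential u) (rho u)]].

Definition objective (R : realType) (s N : nat) (p : pnp_data R s N) (tau : R)
    (u : unknowns R s N) : R :=
  let h := mesh p in
  let phi k := potential u 0 (inord k) in
  h / (2 * tau) * (\sum_(j < N) \sum_(i < s)
      average (row i (flux u)) 0 j ^+ 2 / rho u i j
        * (diffusivity p i (center p j))^-1)
  + h * (\sum_(j < N) (\sum_(i < s) rho u i j * ln (rho u i j)
      + permittivity p (center p j) / (8 * h ^+ 2) * (phi j.+2 - phi j) ^+ 2))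
  + (phi 0%N + phi 1%N) ^+ 2 / (8 * robin_left p)
  + (phi N + phi N.+1) ^+ 2 / (8 * robin_right p).

Definition minimizers (R : realType) (T : Type) (F : T -> R) (A : set T) : set T :=
  [set u | A u /\ forall v, A v -> F u <= F v].

Definition scheme (R : realType) (s N : nat) (p : pnp_data R s N) (tau delta : R)
    (rho0 : 'M[R]_(s, N)) : set (nat -> 'M[R]_(s, N)) :=
  [set r | r 0%N = rho0 /\
     forall n, exists2 u, minimizers (objective p tau) (admissible p delta (r n)) u
                        & rho u = r n.+1].

(* Main.v *)
Require Import Defs.
From HB Require Import structures.
From mathcomp Require Import all_boot all_order all_algebra.
From mathcomp Require Import all_classical all_reals all_analysis.
From mathcomp Require Import ring lra.

Set Implicit Arguments.
Unset Strict Implicit.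
Unset Printing Implicit Defensive.

Import Order.TTheory GRing.Theory Num.Theory.
Import numFieldNormedType.Exports.

Local Open Scope classical_set_scope.
Local Open Scope ring_scope.

(** The constraints determine the flux and the potential from the density: the
    continuity equation is summed from the left end ([flux_of]), and the
    discrete Poisson problem with Robin conditions is a square linear system
    with trivial kernel ([poisson_op_ker]). The admissible set is therefore the
    graph of an affine map over the compact convex set of densities, on which
    the objective is continuous, and a minimizer exists ([minimizer_exists]).

    The objective is the sum of a transport energy, convex because
    [m ^ 2 / rho] is jointly convex, of a field energy, convex because it is a
    sum of squares, and of the strictly convex entropy. So the minimizing
    density is unique, and with it flux and potential ([minimizer_unique]).

    The minimizer [u] stays off the boundary because the derivative of
    [x ln x] at 0 is [-oo] ([minimizer_off_boundary]). Compare [u] with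
    [(1 - t) u + t v], where [v] is the admissible state of uniform density.
    By convexity the transport and field energies increase by at most
    [t] times their values at [v], and these are bounded independently of
    the previous density, because the flux of [v] is a difference of partial
    masses. If some entry of the density of [u] were [delta], the entropy would
    decrease by about [t |ln delta|] times a positive constant
    ([entropy_drop]), which wins as soon as [delta] is small. Working with
    convexity along this segment avoids any bound on the derivative of the
    transport energy at [u], which may be of order [1 / delta].

    Every minimizer has a density in the same constraint set as the previous
    one, so the scheme can be iterated as soon as [delta] is at most the
    smallest entry of the initial density, and its densities are at least
    [delta]. *)

(** * Convexity of the integrands *)

Section convex_functions.
Variable R : realType.
Implicit Types a b t x y : R.

Definition xlnx x : R := x * ln x.

(** With [w = ln x - ln y] this is [1 + w < expR w], multiplied by [y]. *)
Lemma xlnx_tangent x y : 0 < x -> 0 < y -> x != y ->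
  xlnx x + (1 + ln x) * (y - x) < xlnx y.
Proof.
move=> x0 y0 xy.
have lnxy : ln x - ln y != 0.
  by rewrite subr_eq0; apply: contra xy => /eqP /ln_inj ->; rewrite ?posrE.
have := expR_gt1Dx lnxy; rewrite expRB !lnK ?posrE// ltr_pdivlMr// => H.
rewrite /xlnx; nra.
Qed.

Lemma xlnx_tangent_le x y : 0 < x -> 0 < y ->
  xlnx x + (1 + ln x) * (y - x) <= xlnx y.
Proof.
move=> x0 y0; have [->|xy] := eqVneq x y; first by rewrite subrr mulr0 addr0.
exact/ltW/xlnx_tangent.
Qed.

Lemma xlnx_geN1 x : 0 < x -> -1 <= xlnx x.
Proof.
by move=> x0; have := xlnx_tangent_le ltr01 x0; rewrite /xlnx ln1; lra.
Qed.

Lemma mix_gt0 t x y : 0 <= t <= 1 -> 0 < x -> 0 < y -> 0 < (1 - t) * x + t * y.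
Proof. by move=> ? ? ?; nra. Qed.

(** Average the tangent inequalities taken at the intermediate point: the
    first-order terms cancel. *)
Lemma xlnx_convex t x y : 0 <= t <= 1 -> 0 < x -> 0 < y ->
  xlnx ((1 - t) * x + t * y) <= (1 - t) * xlnx x + t * xlnx y.
Proof.
move=> t01 x0 y0; have m0 := mix_gt0 t01 x0 y0.
have Tx := xlnx_tangent_le m0 x0; have Ty := xlnx_tangent_le m0 y0.
move: (xlnx _) (xlnx x) (xlnx y) (ln _) Tx Ty => g gx gy l Tx Ty.
have : 0 <= (1 - t) * (gx - (g + (1 + l) * (x - ((1 - t) * x + t * y))))
          + t * (gy - (g + (1 + l) * (y - ((1 - t) * x + t * y)))).
  by rewrite addr_ge0// mulr_ge0 ?subr_ge0//; lra.
rewrite -[in X in _ -> X]subr_ge0; congr (_ <= _); ring.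
Qed.

Lemma xlnx_strict_convex t x y : 0 < t < 1 -> 0 < x -> 0 < y -> x != y ->
  xlnx ((1 - t) * x + t * y) < (1 - t) * xlnx x + t * xlnx y.
Proof.
move=> t01 x0 y0 xy; have m0 : 0 < (1 - t) * x + t * y by apply: mix_gt0 => //; lra.
have mx : (1 - t) * x + t * y != x.
  apply: contra xy => /eqP; rewrite mulrBl mul1r -addrA -[RHS]addr0 => /addrI /eqP.
  rewrite addrC -mulrBr mulf_eq0 subr_eq0 eq_sym => /orP[/eqP|//]; lra.
have Tx := xlnx_tangent m0 x0 mx; have Ty := xlnx_tangent_le m0 y0.
move: (xlnx _) (xlnx x) (xlnx y) (ln _) Tx Ty => g gx gy l Tx Ty.
have : 0 < (1 - t) * (gx - (g + (1 + l) * (x - ((1 - t) * x + t * y))))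
          + t * (gy - (g + (1 + l) * (y - ((1 - t) * x + t * y)))).
  by rewrite ltr_pwDl ?mulr_gt0 ?mulr_ge0 ?subr_ge0 ?subr_gt0//; lra.
rewrite -[in X in _ -> X]subr_gt0; congr (_ < _); ring.
Qed.

Lemma sqr_convex t a b : 0 <= t <= 1 ->
  ((1 - t) * a + t * b) ^+ 2 <= (1 - t) * a ^+ 2 + t * b ^+ 2.
Proof.
move=> t01; rewrite -subr_ge0.
rewrite [leRHS](_ : _ = (1 - t) * t * (a - b) ^+ 2); last by ring.
by rewrite mulr_ge0 ?sqr_ge0// mulr_ge0//; lra.
Qed.

(** Joint convexity of the kinetic energy density [m ^ 2 / rho]; the convexity
    defect is [(1 - t) t (a y - b x) ^ 2 / (x y)] over the mixed denominator. *)
Lemma quad_over_lin_convex t a b x y : 0 <= t <= 1 -> 0 < x -> 0 < y ->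
  ((1 - t) * a + t * b) ^+ 2 / ((1 - t) * x + t * y) <=
  (1 - t) * (a ^+ 2 / x) + t * (b ^+ 2 / y).
Proof.
move=> t01 x0 y0; rewrite ler_pdivrMr ?mix_gt0// -subr_ge0.
rewrite [leRHS](_ : _ = (1 - t) * t * (a * y - b * x) ^+ 2 / (x * y)); last first.
  by field; rewrite !gt_eqF.
by rewrite divr_ge0 ?(mulr_ge0 _ (sqr_ge0 _)) ?mulr_ge0//; lra.
Qed.

End convex_functions.

(** * The grid *)

Lemma lift0_inord n (k : 'I_n) : lift ord0 k = inord k.+1 :> 'I_n.+1.
Proof. by apply/val_inj; rewrite [RHS]inordK// ltnS. Qed.

Lemma liftmax_inord n (k : 'I_n) : lift ord_max k = inord k :> 'I_n.+1.
Proof. by apply/val_inj; rewrite [LHS]lift_max [RHS]inordK// ltnS ltnW. Qed.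

Section discretization.
Variables (R : realType) (s N : nat) (p : pnp_data R s N).
Hypotheses (N_gt0 : (0 < N)%N) (p_ok : standing_assumptions p).

Lemma mesh_gt0 : 0 < mesh p.
Proof. by case: p_ok => ab _ _ _ _; rewrite divr_gt0 ?subr_gt0 ?ltr0n. Qed.

Lemma meshM : N%:R * mesh p = right_end p - left_end p.
Proof. by rewrite mulrC divfK// pnatr_eq0 -lt0n. Qed.

Lemma face0 : face p 0 = left_end p.
Proof. by rewrite /face mul0r addr0. Qed.

Lemma faceN : face p N = right_end p.
Proof. by rewrite /face meshM addrC subrK. Qed.

Lemma face_in (k : nat) : (k <= N)%N -> left_end p <= face p k <= right_end p.
Proof.
move=> kN; have h0 := ltW mesh_gt0; rewrite -faceN /face lerDl lerD2l.
by rewrite mulr_ge0//= ler_wpM2r// ler_nat.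
Qed.

Lemma center_in (j : 'I_N) : left_end p <= Defs.center p j <= right_end p.
Proof.
have h0 := mesh_gt0; have /andP[a1 _] := face_in (ltnW (ltn_ord j)).
have /andP[_] := face_in (ltn_ord j); rewrite /Defs.center /face -[j.+1]addn1 natrD.
by move: a1; rewrite /face; nra.
Qed.

Lemma eps_face_gt0 k : (k <= N)%N -> 0 < permittivity p (face p k).
Proof. by move=> kN; case: p_ok => _ _ eps0 _ _; exact/eps0/face_in. Qed.

Lemma eps_center_gt0 (j : 'I_N) : 0 < permittivity p (Defs.center p j).
Proof. by case: p_ok => _ _ eps0 _ _; exact/eps0/center_in. Qed.

Lemma diff_center_gt0 i (j : 'I_N) : 0 < diffusivity p i (Defs.center p j).
Proof. by case: p_ok => _ D0 _ _ _; exact/D0/center_in. Qed.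

(** ** The discrete Poisson problem *)

Definition displacement (phi : 'rV[R]_N.+2) : 'rV[R]_N.+1 :=
  \row_k (permittivity p (face p k) * difference (mesh p) phi 0 k).

Definition robin_left_op (phi : 'rV[R]_N.+2) : R :=
  let ba := robin_left p * permittivity p (left_end p) in
  (mesh p + 2 * ba) * phi 0 (inord 0) + (mesh p - 2 * ba) * phi 0 (inord 1).

Definition robin_right_op (phi : 'rV[R]_N.+2) : R :=
  let bb := robin_right p * permittivity p (right_end p) in
  (mesh p - 2 * bb) * phi 0 (inord N) + (mesh p + 2 * bb) * phi 0 (inord N.+1).

(** The Poisson system has one equation per node: a Robin condition at each
    ghost node and a balance at each cell. Collecting these in one row vector
    of the same length as the potential makes the system square. *)
Definition node_row (l r : R) (c : 'I_N -> R) : 'rV[R]_N.+2 :=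
  \row_k if unlift ord0 k is Some k' then
           if unlift ord_max k' is Some j then c j else r
         else l.

Lemma node_row_inj l r c l' r' c' : node_row l r c = node_row l' r' c' ->
  [/\ l = l', forall j, c j = c' j & r = r'].
Proof.
move=> /rowP E; split.
- by have := E ord0; rewrite !mxE unlift_none.
- by move=> j; have := E (lift ord0 (lift ord_max j)); rewrite !mxE !liftK.
- by have := E (lift ord0 ord_max); rewrite !mxE !liftK unlift_none.
Qed.

Definition poisson_op (phi : 'rV[R]_N.+2) : 'rV[R]_N.+2 :=
  node_row (robin_left_op phi) (robin_right_op phi)
    (fun j => - difference (mesh p) (displacement phi) 0 j).

Definition poisson_rhs (r : 'M[R]_(s, N)) : 'rV[R]_N.+2 :=
  node_row (2 * mesh p * phi_left p) (2 * mesh p * phi_right p)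
    (fun j => fixed_charge p (Defs.center p j) + \sum_(i < s) valence p i * r i j).

Lemma poissonP phi r : poisson p phi r <-> poisson_op phi = poisson_rhs r.
Proof.
split=> [[El Ec Er]|/node_row_inj[El Ec Er]].
  have -> : poisson_op phi = node_row (2 * mesh p * phi_left p)
      (2 * mesh p * phi_right p)
      (fun j => - difference (mesh p) (displacement phi) 0 j).
    by congr node_row; apply/eqP; rewrite -subr_eq0; apply/eqP.
  by congr node_row; apply/funext => j; apply/eqP; rewrite -subr_eq0 opprD addrA;
    apply/eqP/Ec.
split.
- by apply/eqP; rewrite subr_eq0; apply/eqP/El.
- by move=> j; apply/eqP; rewrite -addrA -opprD subr_eq0; apply/eqP/Ec.
- by apply/eqP; rewrite subr_eq0; apply/eqP/Er.
Qed.

Lemma node_row_linear a l r c l' r' c' :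
  node_row (a * l + l') (a * r + r') (fun j => a * c j + c' j) =
  a *: node_row l r c + node_row l' r' c'.
Proof.
apply/rowP => k; rewrite !mxE; case: unliftP => [k' _|//].
by case: unliftP.
Qed.

Lemma poisson_op_linear : linear poisson_op.
Proof.
move=> a u v; rewrite -node_row_linear; congr node_row.
- by rewrite /robin_left_op !mxE; ring.
- by rewrite /robin_right_op !mxE; ring.
- by apply/funext => j; rewrite !mxE; ring.
Qed.

HB.instance Definition _ :=
  GRing.isLinear.Build R 'rV[R]_N.+2 'rV[R]_N.+2 _ poisson_op poisson_op_linear.

(** Uniqueness for the homogeneous problem. The cell equations make the
    displacement a constant [c], so the potential changes from one node to the
    next by [c] times a positive number. The Robin conditions say that the
    boundary value is [robin_left * c] on the left and [- robin_right * c] on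
    the right; comparing with the total change of the potential yields [c]
    times a positive number equal to 0. Hence [c = 0] and the potential is a
    constant of boundary value 0. *)
Lemma poisson_op_ker phi : poisson_op phi = 0 -> phi = 0.
Proof.
have h0 := mesh_gt0; have hN0 : mesh p != 0 by rewrite gt_eqF.
have E0 : 0 = node_row 0 0 (fun=> 0).
  by apply/rowP => k; rewrite !mxE; case: unliftP => // k' _; case: unliftP.
rewrite [X in _ = X -> _]E0 => /node_row_inj[El Ec Er].
pose f k := phi 0 (inord k); pose e k := permittivity p (face p k).
pose c := displacement phi 0 ord0.
have step k : (k <= N)%N -> displacement phi 0 (inord k) = c.
  elim: k => [|k IH] kN; first by
    congr (displacement phi 0 _); apply/val_inj; rewrite /= inordK.
  have := Ec (Ordinal kN); rewrite -(IH (ltnW kN)) mxE lift0_inord liftmax_inord.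
  move/eqP; rewrite oppr_eq0 mulf_eq0 invr_eq0 (negPf hN0) orbF subr_eq0.
  by move/eqP.
have fS k : (k <= N)%N -> f k.+1 = f k + c * (mesh p / e k).
  move=> kN; have e0 : e k != 0 by rewrite gt_eqF// eps_face_gt0.
  rewrite -(step k kN) !mxE lift0_inord liftmax_inord !inordK//.
  by rewrite /f /e in e0 *; field; apply/andP.
have fE k : (k <= N.+1)%N -> f k = f 0%N + c * \sum_(0 <= l < k) mesh p / e l.
  elim: k => [|k IH] kN; first by rewrite big_nil mulr0 addr0.
  by rewrite big_nat_recr//= fS// IH 1?ltnW// mulrDr addrA.
have S_ge0 k : (k <= N)%N -> 0 <= \sum_(1 <= l < k.+1) mesh p / e l.
  move=> kN; rewrite big_nat_cond sumr_ge0// => l; rewrite andbT => /andP[_ lk].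
  by rewrite divr_ge0 ?(ltW h0)// ltW// eps_face_gt0// (leq_trans _ kN).
have [_ _ _ ba bb] := p_ok.
have fl : f 0%N + f 1%N = 2 * robin_left p * c.
  have := fS 0%N isT; rewrite /e face0 => f1.
  have ea : permittivity p (left_end p) != 0 by rewrite -face0 gt_eqF// eps_face_gt0.
  have : robin_left_op phi = 0 by [].
  rewrite /robin_left_op -/(f 0%N) -/(f 1%N) => E.
  apply: (mulfI hN0); rewrite f1; apply/eqP; rewrite -subr_eq0 -E f1; apply/eqP.
  by field.
have fr : f N + f N.+1 = - (2 * robin_right p * c).
  have := fS N (leqnn _); rewrite /e faceN => f1.
  have ea : permittivity p (right_end p) != 0 by rewrite -faceN gt_eqF// eps_face_gt0.
  have : robin_right_op phi = 0 by [].
  rewrite /robin_right_op -/(f N) -/(f N.+1) => E.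
  apply: (mulfI hN0); rewrite f1; apply/eqP; rewrite -subr_eq0 -E f1; apply/eqP.
  by field.
have c0 : c = 0.
  have w1 := S_ge0 _ (leqnn N); have w2 : 0 <= \sum_(1 <= l < N) mesh p / e l.
    by have := S_ge0 _ (leq_pred N); rewrite prednK.
  have e0 : 0 < mesh p / e 0%N by rewrite divr_gt0// eps_face_gt0.
  have := fE _ (leqnn _); have := fE _ (leqnSn _); rewrite (fE 1%N)// in fl.
  rewrite big_nat1 in fl; rewrite big_ltn// (big_ltn (n := N.+1))//.
  move: (\sum_(1 <= l < N) _) (\sum_(1 <= l < N.+1) _) w1 w2 => w w' w1 w2.
  move=> EN EN1; rewrite EN EN1 in fr.
  have /eqP : c * (w + w' + mesh p / e 0%N + 2 * robin_left p + 2 * robin_right p) = 0.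
    by lra.
  rewrite mulf_eq0 => /orP[/eqP//|]; rewrite gt_eqF//; nra.
have f0 : f 0%N = 0 by move: fl; rewrite (fE 1%N)// c0 mul0r mulr0 addr0; lra.
apply/rowP => k; rewrite mxE -[k]inord_val -/(f k) fE ?f0 ?c0 ?mul0r ?addr0//.
by rewrite -ltnS.
Qed.

Lemma poisson_mx_unit : lin1_mx poisson_op \in unitmx.
Proof.
rewrite -row_free_unit; apply: inj_row_free => v.
by rewrite mul_rV_lin1 => /poisson_op_ker.
Qed.

Definition potential_of (r : 'M[R]_(s, N)) : 'rV[R]_N.+2 :=
  poisson_rhs r *m invmx (lin1_mx poisson_op).

Lemma potential_ofP phi r : poisson p phi r <-> phi = potential_of r.
Proof.
rewrite poissonP -mul_rV_lin1 /potential_of; split=> [<-|->].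
  by rewrite mulmxK ?poisson_mx_unit.
by rewrite mulmxKV ?poisson_mx_unit.
Qed.

(** ** The admissible set as a graph over the densities *)

Lemma densities_setP delta (r : 'M[R]_(s, N)) : densities_set p delta r <->
  (forall i j, delta <= r i j) /\ (forall i, mesh p * \sum_j r i j = 1).
Proof.
have E i : \sum_j row i r 0 j = \sum_j r i j by apply: eq_bigr => j _; rewrite mxE.
split=> [H|[H1 H2] i].
  split=> i; have [+ +] := H i; last by rewrite E.
  by move=> + _ j => /(_ j); rewrite mxE.
by split; [move=> j; rewrite mxE | rewrite E].
Qed.

(** The solution of the discrete continuity equation with no flux through the
    left end, obtained by summing the equation from the left. *)
Definition flux_of (rhon r : 'M[R]_(s, N)) : 'M[R]_(s, N.+1) :=
  \matrix_(i, k) (mesh p * \sum_(j < N | (j < k)%N) (rhon i j - r i j)).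

Lemma difference_flux_of rhon r i j :
  difference (mesh p) (row i (flux_of rhon r)) 0 j = rhon i j - r i j.
Proof.
rewrite !mxE lift_max lift0 (bigD1 j)//= (eq_bigl (fun l : 'I_N => (l < j)%N)).
  by rewrite mulrDr addrK mulrC mulKf// gt_eqF// mesh_gt0.
by move=> l; rewrite ltnS [RHS]ltn_neqAle andbC.
Qed.

Lemma flux_inj (m m' : 'M[R]_(s, N.+1)) :
  (forall i, m i ord0 = m' i ord0) ->
  (forall i, difference (mesh p) (row i m) = difference (mesh p) (row i m')) -> m = m'.
Proof.
move=> E0 E; apply/matrixP => i k; rewrite -[k]inord_val.
elim: (k : nat) (ltn_ord k) => [_|l IH lN].
  by rewrite (_ : inord 0 = ord0)//; apply/val_inj; rewrite /= inordK.
have /rowP/(_ (Ordinal (lN : (l < N)%N))) := E i.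
rewrite !mxE lift0_inord liftmax_inord.
rewrite IH 1?ltnW// => /(congr1 (fun x => x * mesh p)).
by rewrite !divfK ?gt_eqF ?mesh_gt0// => /addIr.
Qed.

Definition state_of (rhon r : 'M[R]_(s, N)) : unknowns R s N :=
  Unknowns r (flux_of rhon r) (potential_of r).

(** The flux vanishes at the right end because the two densities have the same
    mass. *)
Lemma admissible_state_of delta (rhon r : 'M[R]_(s, N)) :
  (forall i, mesh p * \sum_j rhon i j = 1) -> densities_set p delta r ->
  admissible p delta rhon (state_of rhon r).
Proof.
move=> Mn dr; have /densities_setP[_ Mr] := dr; split => //=.
- move=> i; rewrite !mxE big_pred0// mulr0; split=> //.
  rewrite (eq_bigl xpredT) => [|j]; last by rewrite /= ltn_ord.
  by rewrite sumrB mulrBr Mn Mr subrr.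
- by move=> i j; rewrite difference_flux_of; ring.
- exact/potential_ofP.
Qed.

(** Flux and potential are functions of the density, so the density is a
    coordinate on the admissible set. *)
Lemma admissible_inj delta rhon u v :
  admissible p delta rhon u -> admissible p delta rhon v -> rho u = rho v -> u = v.
Proof.
case: u v => [r m phi] [r' m' phi'] [/= u1 u2 _ u4] [/= v1 v2 _ v4] rr'.
rewrite -{}rr' in v2 v4 *; congr Unknowns.
  apply: flux_inj => //[i|i]; first by rewrite (u1 i).1 (v1 i).1.
  by apply/rowP => j; apply: (addrI (r i j - rhon i j)); rewrite u2 v2.
by move/potential_ofP: u4 ->; move/potential_ofP: v4 ->.
Qed.

End discretization.

(** * The objective and its convexity *)

Section objective.
Variables (R : realType) (s N : nat) (p : pnp_data R s N) (tau : R).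
Hypotheses (N_gt0 : (0 < N)%N) (p_ok : standing_assumptions p) (tau_gt0 : 0 < tau).

Let h_gt0 : 0 < mesh p := mesh_gt0 N_gt0 p_ok.
Let h_ge0 : 0 <= mesh p := ltW h_gt0.

Let mobility_ge0 : 0 <= mesh p / (2 * tau).
Proof. by apply: divr_ge0 => //; apply: mulr_ge0 => //; exact: ltW. Qed.

Definition transport (u : unknowns R s N) : R :=
  mesh p / (2 * tau) * \sum_(x : 'I_s * 'I_N)
    (average (row x.1 (flux u)) 0 x.2 ^+ 2 / rho u x.1 x.2
      * (diffusivity p x.1 (Defs.center p x.2))^-1).

Definition entropy (r : 'M[R]_(s, N)) : R :=
  \sum_(x : 'I_s * 'I_N) xlnx (r x.1 x.2).

Definition field_energy (phi : 'rV[R]_N.+2) : R :=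
  mesh p * (\sum_(j < N) permittivity p (Defs.center p j) / (8 * mesh p ^+ 2)
      * (phi 0 (inord j.+2) - phi 0 (inord j)) ^+ 2)
  + (phi 0 (inord 0) + phi 0 (inord 1)) ^+ 2 / (8 * robin_left p)
  + (phi 0 (inord N) + phi 0 (inord N.+1)) ^+ 2 / (8 * robin_right p).

Lemma objectiveE u : objective p tau u =
  transport u + mesh p * entropy (rho u) + field_energy (potential u).
Proof.
have dsum (F : 'I_s -> 'I_N -> R) :
  \sum_j \sum_i F i j = \sum_(x : 'I_s * 'I_N) F x.1 x.2.
  by rewrite exchange_big pair_bigA.
by rewrite /objective !dsum big_split/= !dsum mulrDr !addrA.
Qed.

Lemma transport_ge0 u : (forall i j, 0 < rho u i j) -> 0 <= transport u.
Proof.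
move=> u0; rewrite mulr_ge0//; apply: sumr_ge0 => x _.
rewrite mulr_ge0 ?divr_ge0 ?sqr_ge0 ?(ltW (u0 _ _))//.
by rewrite invr_ge0 ltW// diff_center_gt0.
Qed.

Lemma field_energy_ge0 phi : 0 <= field_energy phi.
Proof.
have [_ _ _ ba bb] := p_ok.
have robin (a b : R) : 0 < b -> 0 <= a ^+ 2 / (8 * b).
  by move=> b0; rewrite mulr_ge0 ?sqr_ge0// invr_ge0 mulr_ge0// ltW.
apply: addr_ge0; last exact: robin.
apply: addr_ge0; last exact: robin.
apply: mulr_ge0 => //; apply: sumr_ge0 => j _; apply: mulr_ge0; last exact: sqr_ge0.
by apply: divr_ge0; [exact/ltW/eps_center_gt0 | rewrite mulr_ge0 ?exprn_ge0].
Qed.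

Definition mix t (u v : unknowns R s N) : unknowns R s N :=
  Unknowns ((1 - t) *: rho u + t *: rho v) ((1 - t) *: flux u + t *: flux v)
           ((1 - t) *: potential u + t *: potential v).

Lemma admissible_mix delta rhon t u v : 0 <= t <= 1 ->
  admissible p delta rhon u -> admissible p delta rhon v ->
  admissible p delta rhon (mix t u v).
Proof.
move=> t01 [u1 u2 /densities_setP[u3 u4] u5] [v1 v2 /densities_setP[v3 v4] v5].
split.
- by move=> i; have [a b] := u1 i; have [c d] := v1 i; rewrite !mxE a b c d !mulr0 addr0.
- move=> i j; have := u2 i j; have := v2 i j; rewrite !mxE => E2 E1.
  rewrite -[RHS](_ : (1 - t) * 0 + t * 0 = 0); last by ring.
  by rewrite -{1}E1 -E2; ring.
- apply/densities_setP; split=> [i j|i].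
    by have := u3 i j; have := v3 i j; rewrite !mxE; nra.
  under eq_bigr do rewrite !mxE.
  rewrite big_split/= -!mulr_sumr mulrDr mulrCA u4 mulrCA v4; ring.
- apply/poissonP; move/poissonP: u5 => u5; move/poissonP: v5 => v5.
  rewrite linearD !linearZ /= u5 v5; apply/rowP => k; rewrite !mxE.
  case: unliftP => [k' _|_]; last by ring.
  case: unliftP => [j _|_]; last by ring.
  under [in RHS]eq_bigr do rewrite !mxE mulrDr mulrCA (mulrCA _ t).
  by rewrite big_split/= -!mulr_sumr; ring.
Qed.

(** The flux average is linear in the flux, so the joint convexity of
    [m ^ 2 / rho] applies cell by cell. *)
Lemma transport_mix t u v : 0 <= t <= 1 ->
  (forall i j, 0 < rho u i j) -> (forall i j, 0 < rho v i j) ->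
  transport (mix t u v) <= (1 - t) * transport u + t * transport v.
Proof.
move=> t01 u0 v0.
rewrite (mulrCA (1 - t)) (mulrCA t) -mulrDr.
apply: ler_wpM2l => //.
rewrite !mulr_sumr -big_split/=; apply: ler_sum => x _.
rewrite (mulrA (1 - t)) (mulrA t) -mulrDl ler_wpM2r//.
  by rewrite invr_ge0 ltW// diff_center_gt0.
have := quad_over_lin_convex
  (average (row x.1 (flux u)) 0 x.2) (average (row x.1 (flux v)) 0 x.2)
  t01 (u0 x.1 x.2) (v0 x.1 x.2).
apply: le_trans; rewrite !mxE le_eqVlt; apply/orP; left; apply/eqP.
by congr (_ ^+ 2 / _); ring.
Qed.

Lemma field_energy_mix t phi psi : 0 <= t <= 1 ->
  field_energy ((1 - t) *: phi + t *: psi) <=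
  (1 - t) * field_energy phi + t * field_energy psi.
Proof.
move=> t01; have [_ _ _ ba bb] := p_ok.
have scaled (k a b c : R) : 0 <= k -> c = (1 - t) * a + t * b ->
    c ^+ 2 * k <= (1 - t) * (a ^+ 2 * k) + t * (b ^+ 2 * k).
  by move=> k0 ->; rewrite (mulrA (1 - t)) (mulrA t) -mulrDl ler_wpM2r// sqr_convex.
rewrite /field_energy !mulrDr [leRHS]addrACA; apply: lerD; last first.
  by apply: scaled; [rewrite invr_ge0 mulr_ge0// ltW | rewrite !mxE; ring].
rewrite [leRHS]addrACA; apply: lerD; last first.
  by apply: scaled; [rewrite invr_ge0 mulr_ge0// ltW | rewrite !mxE; ring].
rewrite (mulrCA (1 - t)) (mulrCA t) -mulrDr ler_wpM2l//.
rewrite !mulr_sumr -big_split/=; apply: ler_sum => j _.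
rewrite ![_ / _ * _]mulrC; apply: scaled; last by rewrite !mxE; ring.
by apply: divr_ge0; [exact/ltW/eps_center_gt0 | rewrite mulr_ge0 ?exprn_ge0].
Qed.

Lemma entropy_strict_convex t (r q : 'M[R]_(s, N)) : 0 < t < 1 ->
  (forall i j, 0 < r i j) -> (forall i j, 0 < q i j) -> r != q ->
  entropy ((1 - t) *: r + t *: q) < (1 - t) * entropy r + t * entropy q.
Proof.
move=> t01 r0 q0 /eqP rq; have t01' : 0 <= t <= 1 by lra.
have [x rqx] : exists x : 'I_s * 'I_N, r x.1 x.2 != q x.1 x.2.
  apply/existsP; rewrite -negb_forall; apply/forallP => H; apply: rq.
  by apply/matrixP => i j; have /eqP := H (i, j).
rewrite /entropy !mulr_sumr -big_split/= [ltLHS](bigD1 x)//= [ltRHS](bigD1 x)//=.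
apply: ltr_leD; first by rewrite !mxE; exact: xlnx_strict_convex.
by apply: ler_sum => y _; rewrite !mxE; exact: xlnx_convex.
Qed.

(** Moving a density towards the constant [c] raises the entropy by at most [t]
    times a constant per entry, because [x ln x] is convex and bounded below.
    At an entry equal to [delta] the tangent at the mixed value adds a multiple
    of the logarithm of that value, which is large and negative when [delta]
    and [t] are small. *)
Lemma entropy_drop t delta c (r : 'M[R]_(s, N)) (x : 'I_s * 'I_N) : 0 <= t <= 1 ->
  (forall i j, 0 < r i j) -> 0 < c -> r x.1 x.2 = delta ->
  entropy ((1 - t) *: r + t *: const_mx c) - entropy r <=
  t * ((s * N)%:R * (xlnx c + 1)
       + (c - delta) * (1 + ln ((1 - t) * delta + t * c))).
Proof.
move=> t01 r0 c0 rx; have /andP[t0 _] := t01.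
have B0 : 0 <= xlnx c + 1 by have := xlnx_geN1 c0; lra.
have term y : xlnx (((1 - t) *: r + t *: const_mx c) y.1 y.2) - xlnx (r y.1 y.2)
    <= t * (xlnx c + 1).
  rewrite !mxE; have := xlnx_convex t01 (r0 y.1 y.2) c0.
  by have := xlnx_geN1 (r0 y.1 y.2); nra.
rewrite /entropy -sumrB (bigD1 x)//= mulrDr addrC lerD//.
  apply: (@le_trans _ _ (\sum_(y : 'I_s * 'I_N) t * (xlnx c + 1))); last first.
    by rewrite sumr_const card_prod !card_ord mulrCA -[leLHS]mulr_natl.
  rewrite [leRHS](bigD1 x)//= -[leLHS]add0r lerD ?mulr_ge0//.
  by apply: ler_sum => y _; exact: term.
have d0 : 0 < delta by rewrite -rx.
have := xlnx_tangent_le (mix_gt0 t01 d0 c0) d0; rewrite !mxE rx.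
by set g := xlnx _; set l := ln _; lra.
Qed.

(** * Minimizers are unique and stay off the boundary *)

Definition uniform_density : R := (N%:R * mesh p)^-1.

Lemma uniform_density_gt0 : 0 < uniform_density.
Proof. by rewrite invr_gt0 mulr_gt0 ?ltr0n. Qed.

Lemma uniform_densities delta : delta <= uniform_density ->
  densities_set p delta (const_mx uniform_density : 'M[R]_(s, N)).
Proof.
move=> dc; apply/densities_setP; split=> [i j|i]; first by rewrite mxE.
under eq_bigr do rewrite mxE.
rewrite sumr_const card_ord -mulr_natl mulrA (mulrC (mesh p)) mulfV//.
by rewrite gt_eqF// mulr_gt0 ?ltr0n.
Qed.

(** The flux is a difference of two partial masses, each of which lies between
    0 and 1. *)
Lemma flux_of_bounded delta (rhon r : 'M[R]_(s, N)) i k : 0 <= delta ->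
  densities_set p delta rhon -> densities_set p delta r ->
  `|flux_of p rhon r i k| <= 1.
Proof.
move=> d0 /densities_setP[n1 n2] /densities_setP[r1 r2].
have part (q : 'M[R]_(s, N)) : (forall i j, delta <= q i j) ->
    mesh p * \sum_j q i j = 1 ->
    0 <= mesh p * \sum_(j < N | (j < k)%N) q i j <= 1.
  move=> q0 q1; have q0' j : 0 <= q i j by exact: le_trans (q0 i j).
  rewrite mulr_ge0 ?sumr_ge0//= -q1 ler_wpM2l//.
  by rewrite [leRHS](bigID (fun j : 'I_N => (j < k)%N))/= lerDl sumr_ge0.
have := part _ n1 (n2 i); have := part _ r1 (r2 i).
by rewrite mxE sumrB mulrBr ler_norml; lra.
Qed.

(** Uniformity in [rhon] is what makes the threshold of the next result
    independent of the previous time step. *)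
Lemma transport_uniform_bounded : exists K : R, forall delta rhon, 0 <= delta ->
  delta <= uniform_density -> densities_set p delta rhon ->
  transport (state_of p rhon (const_mx uniform_density)) <= K.
Proof.
exists (mesh p / (2 * tau) * \sum_(x : 'I_s * 'I_N)
  (uniform_density^-1 * (diffusivity p x.1 (Defs.center p x.2))^-1)).
move=> delta rhon d0 dc rn; have ud := uniform_densities dc.
apply: ler_wpM2l => //.
apply: ler_sum => x _; rewrite ler_wpM2r ?invr_ge0 ?(ltW (diff_center_gt0 _ _ _ _))//.
rewrite /= [const_mx _ _ _]mxE -[leRHS]mul1r.
rewrite ler_wpM2r//; first by rewrite invr_ge0 ltW// uniform_density_gt0.
rewrite -(@real_normK _ (average _ _ _)) ?num_real// expr_le1// mxE.
have := flux_of_bounded x.1 (lift ord0 x.2) d0 rn ud.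
have := flux_of_bounded x.1 (lift ord_max x.2) d0 rn ud.
rewrite ![row _ _ _ _]mxE; move: (flux_of _ _ _ _ _) (flux_of _ _ _ _ _) => a b.
by rewrite !ler_norml; lra.
Qed.

(** A minimizer with an entry equal to [delta] is compared with its mixture,
    with weight [t], with the uniform state. Convexity bounds the change of
    transport and field energies by [t] times a constant, and [entropy_drop]
    bounds the change of entropy by [t] times a quantity that tends to
    [-oo] with [delta]. *)
Lemma minimizer_off_boundary : exists2 delta0, 0 < delta0 &
  forall delta rhon u, 0 < delta <= delta0 -> densities_set p delta rhon ->
  minimizers (objective p tau) (admissible p delta rhon) u ->
  forall i j, delta < rho u i j.
Proof.
have c0 := uniform_density_gt0.
set c := uniform_density in c0 *.
have [K HK] := transport_uniform_bounded.
pose Q := field_energy (potential_of p (const_mx c)).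
pose B := (s * N)%:R * (xlnx c + 1).
(* [M] is chosen so that, per unit of the weight [t], the entropy gain
   [mesh * (c / 2) * (M - 1)] exceeds by 1 the sum of all the bounded terms. *)
pose M := 1 + 2 * (`|K| + Q + mesh p * B + 1) / (mesh p * c).
have Q0 : 0 <= Q := field_energy_ge0 _.
have B0 : 0 <= B by rewrite mulr_ge0 ?ler0n//; have := xlnx_geN1 c0; lra.
pose d0 := Num.min (c / 2) (expR (- M) / 2).
have d0c : d0 <= c / 2 by rewrite ge_min lexx.
have d0M : d0 <= expR (- M) / 2 by rewrite ge_min lexx orbT.
have d0_gt0 : 0 < d0 by rewrite lt_min !divr_gt0// expR_gt0.
exists d0 => //.
move=> delta rhon u /andP[delta_gt0 dd0] rn [Vu umin] i j.
have [_ _ /densities_setP[ud um] _] := Vu.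
have u0 k l : 0 < rho u k l by exact: lt_le_trans (ud k l).
rewrite lt_neqAle ud andbT; apply/negP => /eqP/esym uij.
have dc : delta <= c by lra.
pose v := state_of p rhon (const_mx c).
have Vv : admissible p delta rhon v.
  apply: admissible_state_of => //; last exact: uniform_densities.
  by have /densities_setP[] := rn.
have v0 k l : 0 < rho v k l by rewrite mxE.
(* With this weight the mixed entry is at most [2 * delta], so its logarithm
   is at most [- M]. *)
pose t := delta / c.
have tc : t * c = delta by rewrite /t divfK// gt_eqF.
have t_gt0 : 0 < t by rewrite divr_gt0.
have t01 : 0 <= t <= 1 by rewrite ltW//= /t ler_pdivrMr ?mul1r.
have := umin _ (admissible_mix t01 Vu Vv); rewrite !objectiveE.
have := transport_mix t01 u0 v0; have := transport_ge0 u0.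
have := field_energy_mix (potential u) (potential v) t01.
have := field_energy_ge0 (potential u).
have Kv : transport v <= K by apply: HK rn => //; lra.
have := @entropy_drop t delta c (rho u) (i, j) t01 u0 c0 uij.
have lnM : ln ((1 - t) * delta + t * c) <= - M.
  rewrite -[leRHS]expRK ler_ln ?posrE ?expR_gt0// ?tc; nra.
rewrite /= -/Q -/B.
move: (entropy (rho u)) (entropy (_ + _)) => E E'.
move: (transport (mix t u v)) (transport u) (transport v) Kv => T' T Tv Kv.
move: (field_energy (potential u)) (field_energy (_ + _)) (ln _) lnM => F F' l lnM.
move=> HE F0 HF T0 HT Hmin.
have tT : 0 <= t * T by rewrite mulr_ge0// ltW.
have tF : 0 <= t * F by rewrite mulr_ge0// ltW.
have {Hmin} Hmin : 0 <= t * Tv + t * Q + mesh p * (E' - E) by lra.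
have {HE} HE : mesh p * (E' - E) <= mesh p * (t * (B + (c - delta) * (1 + l))).
  by rewrite ler_pM2l.
have {Hmin HE} : 0 <= t * (Tv + Q + mesh p * B + mesh p * ((c - delta) * (1 + l))).
  by lra.
rewrite pmulr_rge0// leNgt => /negP; apply.
pose S := `|K| + Q + mesh p * B + 1.
have S_gt0 : 0 < S.
  by have := mulr_ge0 h_ge0 B0; have := normr_ge0 K; rewrite /S; lra.
have ME : mesh p * c * (M - 1) = 2 * S.
  by rewrite /M -/S; field; rewrite !gt_eqF.
have l1 : 1 + l <= - (M - 1) by lra.
have M1 : 0 < M - 1.
  by have := mulr_gt0 (ltr0Sn R 1) S_gt0; rewrite -ME pmulr_rgt0// mulr_gt0.
have : (c - delta) * (1 + l) <= c / 2 * - (M - 1) by nra.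
rewrite -(ler_pM2l h_gt0) => H.
have KK := ler_norm K; have SE : S = `|K| + Q + mesh p * B + 1 by [].
lra.
Qed.

(** Two minimizers with distinct densities would both be beaten by their
    midpoint, by strict convexity of the entropy. *)
Lemma minimizer_unique delta rhon u v : 0 < delta ->
  minimizers (objective p tau) (admissible p delta rhon) u ->
  minimizers (objective p tau) (admissible p delta rhon) v -> u = v.
Proof.
move=> d0 [Vu umin] [Vv vmin]; apply: (admissible_inj N_gt0 p_ok Vu Vv).
apply/eqP/negP => /negP uv.
have [_ _ /densities_setP[ud _] _] := Vu; have [_ _ /densities_setP[vd _] _] := Vv.
have u0 k l : 0 < rho u k l by exact: lt_le_trans (ud k l).
have v0 k l : 0 < rho v k l by exact: lt_le_trans (vd k l).
have t01 : 0 < (2^-1 : R) < 1 by lra.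
have t01' : 0 <= (2^-1 : R) <= 1 by lra.
have := umin _ (admissible_mix t01' Vu Vv); have := vmin _ Vu.
rewrite !objectiveE /=.
have := transport_mix t01' u0 v0.
have := field_energy_mix (potential u) (potential v) t01'.
have := entropy_strict_convex t01 u0 v0 uv.
rewrite -(ltr_pM2l h_gt0).
lra.
Qed.

End objective.

(** * Existence of minimizers *)

Section existence.

Lemma cvg_sumr (R : realType) (T I : Type) (F : set_system T) {FF : Filter F}
    (r : seq I) (P : pred I) (f : I -> T -> R) (l : I -> R) :
  (forall i, P i -> f i x @[x --> F] --> l i) ->
  \sum_(i <- r | P i) f i x @[x --> F] --> \sum_(i <- r | P i) l i.
Proof.
move=> fl; elim: r => [|i r IH].
  by rewrite big_nil; under eq_fun do rewrite big_nil; exact: cvg_cst.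
rewrite big_cons; under eq_fun do rewrite big_cons.
by case: ifP => // Pi; apply: cvgD => //; exact: fl.
Qed.

Variables (R : realType) (s N : nat) (p : pnp_data R s N) (tau : R).
Hypotheses (N_gt0 : (0 < N)%N) (p_ok : standing_assumptions p).

Let h_gt0 : 0 < mesh p := mesh_gt0 N_gt0 p_ok.

(** Limits are taken along an abstract filter and entry by entry, so that no
    topology on the type of densities is involved. *)
Section entrywise_limits.
Variables (T : Type) (F : set_system T) (FF : Filter F).
Variables (r : T -> 'M[R]_(s, N)) (r0 : 'M[R]_(s, N)).
Hypothesis rF : forall i j, r x i j @[x --> F] --> r0 i j.

Lemma flux_of_cvg rhon i k :
  flux_of p rhon (r x) i k @[x --> F] --> flux_of p rhon r0 i k.
Proof.
rewrite mxE; under eq_fun do rewrite mxE.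
apply: cvgM; first exact: cvg_cst.
by apply: cvg_sumr => j _; apply: cvgB; [exact: cvg_cst | exact: rF].
Qed.

Lemma mass_cvg i :
  mesh p * \sum_j r x i j @[x --> F] --> mesh p * \sum_j r0 i j.
Proof. by apply: cvgM; [exact: cvg_cst | apply: cvg_sumr => j _; exact: rF]. Qed.

Lemma potential_of_cvg k :
  potential_of p (r x) 0 k @[x --> F] --> potential_of p r0 0 k.
Proof.
rewrite mxE; under eq_fun do rewrite mxE.
apply: cvg_sumr => l _; apply: cvgM; last exact: cvg_cst.
rewrite mxE; under eq_fun do rewrite mxE.
case: unliftP => [l' _|_]; last exact: cvg_cst.
case: unliftP => [j _|_]; last exact: cvg_cst.
apply: cvgD; first exact: cvg_cst.
by apply: cvg_sumr => i _; apply: cvgM; [exact: cvg_cst | exact: rF].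
Qed.

Lemma objective_cvg rhon :
  (forall i j, 0 < r0 i j) ->
  objective p tau (state_of p rhon (r x)) @[x --> F] -->
  objective p tau (state_of p rhon r0).
Proof.
move=> r0_gt0; rewrite objectiveE; under eq_fun do rewrite objectiveE.
have sqr (f : T -> R) (l : R) : f x @[x --> F] --> l -> f x ^+ 2 @[x --> F] --> l ^+ 2.
  by move=> fl; exact: cvgM.
have phi := potential_of_cvg.
apply: cvgD; first apply: cvgD; last apply: cvgD.
- apply: cvgM; first exact: cvg_cst.
  apply: cvg_sumr => -[i j] _ /=; apply: cvgM; last exact: cvg_cst.
  apply: cvgM; last by apply: cvgV; [rewrite gt_eqF | exact: rF].
  apply: sqr; rewrite mxE; under eq_fun do rewrite mxE.
  apply: cvgM; last exact: cvg_cst.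
  by apply: cvgD; rewrite mxE; under eq_fun do rewrite mxE; exact: flux_of_cvg.
- apply: cvgM; first exact: cvg_cst.
  apply: cvg_sumr => -[i j] _ /=; apply: cvgM; first exact: rF.
  by apply: continuous_cvg; [exact: continuous_ln | exact: rF].
- apply: cvgD; last by apply: cvgM; [apply: sqr; exact: cvgD | exact: cvg_cst].
  apply: cvgM; first exact: cvg_cst.
  by apply: cvg_sumr => j _; apply: cvgM; [exact: cvg_cst | apply: sqr; exact: cvgB].
- by apply: cvgM; [apply: sqr; exact: cvgD | exact: cvg_cst].
Qed.

End entrywise_limits.

(** Compactness is established for row vectors; the densities are matrices,
    flattened by [mxvec]. *)
Lemma entry_cvg (w0 : 'rV[R]_(s * N)) i j :
  vec_mx w i j @[w --> w0] --> vec_mx w0 i j.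
Proof.
rewrite mxE; under eq_fun do rewrite mxE.
exact: coord_continuous.
Qed.

Lemma densities_compact delta : 0 <= delta ->
  compact [set w : 'rV[R]_(s * N) | densities_set p delta (vec_mx w)].
Proof.
move=> d0.
have box : compact [set w : 'rV[R]_(s * N) | forall k, `[0, (mesh p)^-1]%classic (w 0 k)].
  by apply: (@rV_compact _ _ (fun=> `[0, (mesh p)^-1]%classic)) => k;
    exact: segment_compact.
apply: subclosed_compact box _.
- rewrite (_ : mkset _ =
    (\bigcap_(x in [set: 'I_s * 'I_N]) [set w | delta <= vec_mx w x.1 x.2]) `&`
    (\bigcap_(i in [set: 'I_s]) [set w | mesh p * \sum_j vec_mx w i j = 1])); last first.
    apply/seteqP; split=> w.
      by move=> /densities_setP[w1 w2]; split=> [x _|i _]; [exact: w1 | exact: w2].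
    by move=> [w1 w2]; apply/densities_setP; split=> [i j|i];
      [exact: (w1 (i, j)) | exact: w2].
  apply: closedI.
    apply: closed_bigI => x _.
    apply: (@preimage_closed _ _ (fun w => vec_mx w x.1 x.2) [set y | delta <= y]).
      by move=> w _; exact: entry_cvg.
    exact: closed_ge.
  apply: closed_bigI => i _.
  apply: (@preimage_closed _ _ (fun w => mesh p * \sum_j vec_mx w i j) [set y | y = 1]).
    by move=> w _; exact: (@mass_cvg _ _ _ vec_mx _ (@entry_cvg w)).
  exact: closed_eq.
- move=> w /densities_setP[w1 w2] k; rewrite -[w]vec_mxK; case/mxvec_indexP: k => i j.
  rewrite mxvecE /= in_itv/= (le_trans d0)//= -[leRHS]mul1r ler_pdivlMr// -(w2 i).
  rewrite mulrC ler_pM2l// (bigD1 j)//= lerDl sumr_ge0// => l _.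
  exact: le_trans (w1 i l).
Qed.

(** The admissible set is the graph over a compact set of densities, bounded
    away from 0, on which the objective is continuous. *)
Lemma minimizer_exists delta rhon : 0 < delta -> densities_set p delta rhon ->
  exists u, minimizers (objective p tau) (admissible p delta rhon) u.
Proof.
move=> d0 rn; have [_ Mn] := (densities_setP p delta rhon).1 rn.
pose A := [set w : 'rV[R]_(s * N) | densities_set p delta (vec_mx w)].
pose f w := objective p tau (state_of p rhon (vec_mx w)).
have A0 : A !=set0 by exists (mxvec rhon); rewrite /A /= mxvecK.
have fA : {within A, continuous f}.
  apply: continuous_in_subspaceT => w; rewrite inE => /densities_setP[w1 _].
  apply: (@objective_cvg _ (nbhs w) _ vec_mx (vec_mx w) (@entry_cvg w)) => i j.
  exact: lt_le_trans (w1 i j).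
have [w wA wmin] := compact_EVT_min A0 (densities_compact (ltW d0)) fA.
rewrite inE in wA.
exists (state_of p rhon (vec_mx w)); split; first exact: admissible_state_of.
move=> v Vv; have [_ _ rv _] := Vv.
have -> : v = state_of p rhon (vec_mx (mxvec (rho v))).
  apply: (admissible_inj N_gt0 p_ok Vv); last by rewrite /= mxvecK.
  by rewrite mxvecK; exact: admissible_state_of.
by apply: wmin; rewrite inE /A /= mxvecK.
Qed.

End existence.

Theorem theorem3p2 (R : realType) (s N : nat) (s_ge1 : (1 <= s)%N) (N_ge1 : (1 <= N)%N)
    (p : pnp_data R s N) (p_ok : standing_assumptions p) (tau : R) (tau_gt0 : 0 < tau) :
  (exists2 delta0 : R, 0 < delta0 &
    forall delta : R, 0 < delta <= delta0 ->
    forall rhon : 'M[R]_(s, N), densities_set p delta rhon ->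
    exists2 u : unknowns R s N,
      unique (minimizers (objective p tau) (admissible p delta rhon)) u &
      forall (i : 'I_s) (j : 'I_N), delta < rho u i j)
  /\
  (forall rho0 : 'M[R]_(s, N),
    (forall (i : 'I_s) (j : 'I_N), 0 < rho0 i j) ->
    (forall i : 'I_s, mesh p * \sum_(j < N) rho0 i j = 1) ->
    exists2 delta1 : R, 0 < delta1 &
      forall delta : R, 0 < delta <= delta1 ->
      exists2 r : nat -> 'M[R]_(s, N),
        unique (scheme p tau delta rho0) r &
        forall n : nat, (0 < n)%N ->
        forall (i : 'I_s) (j : 'I_N), 0 < r n i j).
Proof.
have [d0 d0_gt0 inner] := minimizer_off_boundary N_ge1 p_ok tau_gt0.
split.
  exists d0 => // delta dd0 rhon rn; have /andP[d_gt0 _] := dd0.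
  have [u umin] := minimizer_exists tau N_ge1 p_ok d_gt0 rn.
  exists u; last exact: inner umin.
  by split=> // v; exact: minimizer_unique.
move=> rho0 rho0_gt0 rho0_mass.
exists (\big[Num.min/1]_(x : 'I_s * 'I_N) rho0 x.1 x.2).
  by apply/bigmin_gtP; split=> [|x _]; [exact: ltr01 | exact: rho0_gt0].
move=> delta /andP[d_gt0 d_le].
have rn0 : densities_set p delta rho0.
  apply/densities_setP; split=> // i j.
  apply: le_trans d_le _.
  exact: (@bigmin_le_cond _ _ _ _ (i, j) xpredT (fun x => rho0 x.1 x.2)).
(* A minimizer exists only for densities in the constraint set, so the
   selection is totalized by an arbitrary value elsewhere. *)
have next rhon : {u | densities_set p delta rhon ->
    minimizers (objective p tau) (admissible p delta rhon) u}.
  apply: cid; have [rn|nrn] := pselect (densities_set p delta rhon).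
    by have [u umin] := minimizer_exists tau N_ge1 p_ok d_gt0 rn; exists u.
  by exists (state_of p rho0 rho0).
have nextP rhon : densities_set p delta rhon ->
    minimizers (objective p tau) (admissible p delta rhon) (sval (next rhon)).
  exact: svalP (next rhon).
pose r n := iter n (fun rhon => rho (sval (next rhon))) rho0.
have rd n : densities_set p delta (r n).
  by elim: n => // n /nextP[[_ _ ]].
exists r; last first.
  by move=> n _ i j; have /densities_setP[+ _] := rd n => /(_ i j); exact: lt_le_trans.
split.
  by split=> // n; exists (sval (next (r n))) => //; exact: nextP.
move=> q [q0 qS]; apply/funext; elim=> [|n IH]; first by rewrite q0.
have [u umin <-] := qS n; rewrite -IH in umin.
by rewrite /= -(minimizer_unique N_ge1 p_ok tau_gt0 d_gt0 (nextP _ (rd n)) umin).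
Qed.
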